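(* Consider the problem $\mathcal{P}_2$ in which the demand response aggregator (DRA) uses the bonus function $B_i(R_i)=\mu(R_i-R_0)$ for all customers $i$, with $R_0\ge 0$ a specified constant, and chooses $\mu$ and $\{\alpha_i\}$ to maximize $\mathbb{E}_{\mathcal{E}}[\Pi]$ subject to: each customer $i$ chooses $a_i,R_i$ to maximize $\mathbb{E}_{\mathcal{E}}[V_i]$; $\mu\ge 0$; individual rationality $\mathbb{E}[V_i]\ge 0$; and incentive compatibility, $\mu=\beta_i(R_i-x_i)$ and $\partial R_i/\partial x_i\ge 0$. Assume $\beta_i=\beta$ for all $i$. Then: (1) The optimal contract obtained as a solution to the problem is specified by the relations $$\mu^*=\frac{R_0\beta}{2},\qquad \alpha_i^*=0.5-\mu^*.$$ (2) In response to this optimal contract, every customer $i$ over-reports her true load reduction as $R_i^*=x_i+\frac{\mu^*}{\beta}$, and exerts the effort $a_i^*=\mu^*+\alpha_i^*$.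
   Context: A DRA contracts with $N$ customers. Customer $i$ chooses a hidden effort $a_i\in\mathbb{R}$ at cost $h(a_i)=a_i^2/2$; the true load reduction is $x_i=a_i+e_i$, where the $e_i$ are i.i.d. with mean $0$ and variance $\sigma^2$. After learning her own $x_i$, customer $i$ reports a load reduction $R_i\in\mathbb{R}$, incurring a falsification cost $\beta_i(R_i-x_i)^2/2$, $\beta_i>0$. She receives $P_i=\alpha_i x_i+B_i(R_i)$, where $\alpha_i$ is a constant share. The utilities of customer $i$ and of the DRA are $$V_i=\alpha_i x_i+B_i(R_i)-h(a_i)-\beta_i\frac{(R_i-x_i)^2}{2},\qquad \Pi=\sum_{i=1}^N(1-\alpha_i)x_i-\sum_{i=1}^N B_i(R_i).$$ $\mathbb{E}_{\mathcal{E}}$ is the expectation over $e_1,\dots,e_N$.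
   Formalization: The formal theorem adds the assumption 3βR_0² ≤ 1, which holds exactly when the stated contract satisfies individual rationality E[V_i] ≥ 0; without it (e.g. β = R_0 = 1, where E[V_i] = -1/4) the stated contract is infeasible. It also assumes N ≥ 1. *)

(* Defs.v *)
(* MathComp-Analysis, over an abstract realType R. *)
From HB Require Import structures.
From mathcomp Require Export all_boot all_order all_algebra.
From mathcomp Require Export all_classical all_reals all_analysis.

Set Implicit Arguments.
Unset Strict Implicit.
Unset Printing Implicit Defensive.

Import Order.TTheory GRing.Theory Num.Theory numFieldNormedType.Exports.

Local Open Scope classical_set_scope.
Local Open Scope ring_scope.

Definition mutually_independent (d : measure_display) (T : measurableType d)
    (R : realType) (P : probability T R) (N : nat)
    (X : 'I_N -> {RV P >-> R}) : Prop :=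
  forall (J : {set 'I_N}) (A : 'I_N -> set R),
    (forall i, measurable (A i)) ->
    P (\bigcap_(i in [set j | j \in J]) (X i @^-1` A i)) =
    (\prod_(i in J) P (X i @^-1` A i))%E.

(* Together with the zero mean, a finite value of 'V_P[e i] makes e i square
   integrable. *)
Definition iid_noise (d : measure_display) (T : measurableType d)
    (R : realType) (P : probability T R) (N : nat)
    (e : 'I_N -> {RV P >-> R}) (sigma : R) : Prop :=
  [/\ mutually_independent e,
      (forall i j, distribution P (e i) = distribution P (e j)),
      (forall i, 'E_P[e i]%E = 0%:E) &
      (forall i, 'V_P[e i]%E = (sigma ^+ 2)%:E)].

Definition effort_cost (R : realType) (a : R) : R := a ^+ 2 / 2.

Definition falsification_cost (R : realType) (beta_i rep x : R) : R :=
  beta_i * (rep - x) ^+ 2 / 2.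

Definition customer_utility (R : realType) (alpha_i beta_i : R) (B_i : R -> R)
    (a x rep : R) : R :=
  alpha_i * x + B_i rep - effort_cost a - falsification_cost beta_i rep x.

Definition DRA_utility (R : realType) (N : nat) (alpha : 'I_N -> R)
    (B : 'I_N -> R -> R) (x rep : 'I_N -> R) : R :=
  \sum_(i < N) (1 - alpha i) * x i - \sum_(i < N) B i (rep i).

Definition linear_bonus (R : realType) (R0 mu : R) : R -> R :=
  fun rep => mu * (rep - R0).

(* The true load reduction is the effort plus the noise.  The report is made
   after the customer has observed it, so a reporting choice is a function
   rho : R -> R giving the report rho x when the true load reduction is x. *)
Definition load_reduction (d : measure_display) (T : measurableType d)
    (R : realType) (P : probability T R) (e_i : {RV P >-> R}) (a : R) : T -> R :=
  fun w => a + e_i w.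

Definition expected_customer_utility (d : measure_display)
    (T : measurableType d) (R : realType) (P : probability T R)
    (e_i : {RV P >-> R}) (beta_i R0 mu alpha_i a : R) (rho : R -> R) : \bar R :=
  'E_P[fun w => let x := load_reduction e_i a w in
         customer_utility alpha_i beta_i (linear_bonus R0 mu) a x (rho x)]%E.

Definition expected_DRA_utility (d : measure_display) (T : measurableType d)
    (R : realType) (P : probability T R) (N : nat) (e : 'I_N -> {RV P >-> R})
    (R0 mu : R) (alpha a : 'I_N -> R) (rho : 'I_N -> R -> R) : \bar R :=
  'E_P[fun w => let x := fun i => load_reduction (e i) (a i) w in
         DRA_utility alpha (fun=> linear_bonus R0 mu) x
           (fun i => rho i (x i))]%E.

(* For beta_i > 0 the utility is bounded above by an integrable function, so
   its expectation is meaningful in [-oo, +oo[ for every measurable reporting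
   rule; no integrability restriction on the deviations is needed. *)
Definition best_response (d : measure_display) (T : measurableType d)
    (R : realType) (P : probability T R) (e_i : {RV P >-> R})
    (beta_i R0 mu alpha_i a : R) (rho : R -> R) : Prop :=
  measurable_fun [set: R] rho /\
  forall (a' : R) (rho' : R -> R), measurable_fun [set: R] rho' ->
    (expected_customer_utility e_i beta_i R0 mu alpha_i a' rho' <=
     expected_customer_utility e_i beta_i R0 mu alpha_i a rho)%E.

Definition incentive_compatible (R : realType) (beta_i mu : R)
    (rho : R -> R) : Prop :=
  (forall x, mu = beta_i * (rho x - x)) /\
  (forall x, derivable rho x 1 /\ 0 <= derive1 rho x).

Definition P2_feasible (d : measure_display) (T : measurableType d)
    (R : realType) (P : probability T R) (N : nat) (e : 'I_N -> {RV P >-> R})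
    (beta_ : 'I_N -> R) (R0 mu : R) (alpha a : 'I_N -> R)
    (rho : 'I_N -> R -> R) : Prop :=
  [/\ (forall i, best_response (e i) (beta_ i) R0 mu (alpha i) (a i) (rho i)),
      0 <= mu,
      (forall i, (0 <= expected_customer_utility (e i) (beta_ i) R0 mu
                         (alpha i) (a i) (rho i))%E) &
      (forall i, incentive_compatible (beta_ i) mu (rho i))].

Definition P2_solution (d : measure_display) (T : measurableType d)
    (R : realType) (P : probability T R) (N : nat) (e : 'I_N -> {RV P >-> R})
    (beta_ : 'I_N -> R) (R0 mu : R) (alpha a : 'I_N -> R)
    (rho : 'I_N -> R -> R) : Prop :=
  P2_feasible e beta_ R0 mu alpha a rho /\
  forall mu' alpha' a' rho', P2_feasible e beta_ R0 mu' alpha' a' rho' ->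
    (expected_DRA_utility e R0 mu' alpha' a' rho' <=
     expected_DRA_utility e R0 mu alpha a rho)%E.

Definition optimal_contract (d : measure_display) (T : measurableType d)
    (R : realType) (P : probability T R) (N : nat) (e : 'I_N -> {RV P >-> R})
    (beta_ : 'I_N -> R) (R0 mu : R) (alpha : 'I_N -> R) : Prop :=
  exists a rho, P2_solution e beta_ R0 mu alpha a rho.

(* Main.v *)
(** Completing the square in the report and then in the effort gives
      [V = (alpha + mu) x - a^2/2 - mu R0 + mu^2/(2 beta)
           - beta/2 (R - x - mu/beta)^2],
    so the best response is [R = x + mu/beta] almost surely and
    [a = alpha + mu].  Writing [s_i = alpha_i + mu], the DRA then expects
    [sum_i (s_i (1 - s_i) - mu^2/beta + mu R0)], a strictly concave function
    of [(s, mu)] maximal exactly at [s_i = 1/2], [mu = beta R0/2]; there every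
    customer expects [(1 - 3 beta R0^2)/8], which is nonnegative. *)
Require Import Defs.
From mathcomp Require Import measurable_realfun ring.
Import Order.TTheory GRing.Theory Num.Theory numFieldNormedType.Exports.
Set Implicit Arguments.
Unset Strict Implicit.
Unset Printing Implicit Defensive.
Local Open Scope classical_set_scope.
Local Open Scope ring_scope.

(** * Comparing expectations of measurable, possibly non-integrable functions *)

Lemma le_integral_measurable (d : measure_display) (T : measurableType d)
    (R : realType) (m : {measure set T -> \bar R}) (f g : T -> \bar R) :
  measurable_fun [set: T] f -> measurable_fun [set: T] g ->
  (forall x, f x <= g x)%E ->
  (\int[m]_x f x <= \int[m]_x g x)%E.
Proof.
(* Positive parts increase and negative parts decrease; subtraction is monotone on all extended
   reals, so no finiteness is required. *)
move=> mf mg fg; rewrite integralE [leRHS]integralE leeB//.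
- apply: ge0_le_integral => //; [exact: measurable_funepos..|].
  by move=> x _; apply: (@funepos_le _ _ setT); rewrite ?inE.
- apply: ge0_le_integral => //; [exact: measurable_funeneg..|].
  by move=> x _; apply: (@funeneg_le _ _ setT); rewrite ?inE.
Qed.

Section expectation.
Context {d : measure_display} {T : measurableType d} {R : realType}.
Variable P : probability T R.
Implicit Types f g : T -> R.

(** An integral is finite only if that of the absolute value is; this extracts integrability of the
    noise from its zero mean. *)
Lemma integrable_expectation_fin_num f :
  measurable_fun [set: T] f -> 'E_P[f]%E \is a fin_num ->
  P.-integrable [set: T] (EFin \o f).
Proof.
rewrite unlock => mf Ef; apply/integrableP; split; first exact/measurable_EFinP.
by rewrite [X in (X < _)%E](_ : _ = (\int[P]_x `|(f x)%:E|)%E)//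
  integral_fin_num_abs.
Qed.

Lemma le_expectation_measurable f g :
  measurable_fun [set: T] f -> measurable_fun [set: T] g ->
  (forall x, f x <= g x) -> ('E_P[f] <= 'E_P[g])%E.
Proof.
move=> mf mg fg; rewrite unlock; apply: le_integral_measurable.
- exact/measurable_EFinP.
- exact/measurable_EFinP.
- by move=> x; rewrite lee_fin.
Qed.

(** The nonnegative function [g - f] has integral zero, hence vanishes almost everywhere. Finiteness
    lets the two integrals be subtracted. *)
Lemma eq_expectation_ae_eq f g :
  measurable_fun [set: T] f -> measurable_fun [set: T] g ->
  (forall x, f x <= g x) -> 'E_P[f]%E = 'E_P[g]%E -> 'E_P[g]%E \is a fin_num ->
  {ae P, forall x, f x = g x}.
Proof.
move=> mf mg fg Efg Eg.
have Ig := integrable_expectation_fin_num mg Eg.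
have If : P.-integrable [set: T] (EFin \o f).
  by apply: integrable_expectation_fin_num; rewrite ?Efg.
have I0 : (\int[P]_x `|(g x - f x)%:E| = 0)%E.
  transitivity (\int[P]_x ((g x)%:E - (f x)%:E))%E.
    apply: eq_integral => x _.
    by rewrite abse_EFin ger0_norm ?subr_ge0// EFinB.
  rewrite integralB_EFin//; move: Eg Efg; rewrite unlock => Eg ->.
  by rewrite subee.
have /ae_eq_integral_abs h : measurable_fun [set: T] (fun x => (g x - f x)%:E).
  by apply/measurable_EFinP; exact: measurable_funB.
have := (h P measurableT).1 I0.
apply: filterS => x /(_ Logic.I) /= [] /eqP.
by rewrite subr_eq0 => /eqP.
Qed.

Lemma expectation_affine (X : T -> R) (c k : R) :
  P.-integrable [set: T] (EFin \o X) -> 'E_P[X]%E = 0%:E ->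
  P.-integrable [set: T] (EFin \o (fun w => c + k * X w)) /\
  'E_P[(fun w => c + k * X w)%R]%E = c%:E.
Proof.
move=> IX EX.
have Ic : P.-integrable [set: T] (EFin \o cst c).
  exact: finite_measure_integrable_cst.
have IkX : P.-integrable [set: T] (EFin \o (fun w => k * X w)).
  have -> : EFin \o (fun w => k * X w) = (fun w => k%:E * (EFin \o X) w)%E.
    by apply/funext => w /=; rewrite EFinM.
  exact: integrableZl.
split.
  have -> : EFin \o (fun w => c + k * X w) =
            (EFin \o cst c) \+ (EFin \o (fun w => k * X w)).
    by apply/funext => w /=; rewrite EFinD.
  exact: integrableD.
have -> : (fun w => c + k * X w) = cst c \+ (k \o* X).
  by apply/funext => w /=; rewrite mulrC.
rewrite expectationD; last 2 first.
- exact/Lfun1_integrable.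
- apply/Lfun1_integrable; rewrite [k \o* X](_ : _ = fun w => k * X w)//.
  by apply/funext => w /=; rewrite mulrC.
rewrite expectation_cst expectationZl ?EX ?mule0 ?adde0//.
exact/Lfun1_integrable.
Qed.

End expectation.

Lemma customer_utility_square (R : realType) (alpha beta R0 mu a x rep : R) :
  beta != 0 ->
  customer_utility alpha beta (linear_bonus R0 mu) a x rep =
  (alpha + mu) * x - a ^+ 2 / 2 - mu * R0 + mu ^+ 2 / (2 * beta) -
  beta / 2 * (rep - (x + mu / beta)) ^+ 2.
Proof.
rewrite /customer_utility /linear_bonus /effort_cost /falsification_cost => b0.
by field.
Qed.

(** * The customer's best response to a linear bonus *)

Section response.
Context {d : measure_display} {T : measurableType d} {R : realType}.
Variables (P : probability T R) (e : {RV P >-> R}) (beta R0 mu alpha : R).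
Hypotheses (beta_gt0 : 0 < beta) (Ee : 'E_P[e]%E = 0%:E).

Local Notation rep := (fun x : R => x + mu / beta).
Local Notation EV := (expected_customer_utility e beta R0 mu alpha).

Lemma noise_integrable : P.-integrable [set: T] (EFin \o e).
Proof. by apply: integrable_expectation_fin_num; rewrite ?Ee. Qed.

Lemma measurable_shift_report : measurable_fun [set: R] rep.
Proof. by apply: measurable_funD. Qed.

Lemma measurable_customer_utility (a : R) (rho : R -> R) :
  measurable_fun [set: R] rho ->
  measurable_fun [set: T] (fun w => let x := load_reduction e a w in
    customer_utility alpha beta (linear_bonus R0 mu) a x (rho x)).
Proof.
move=> mrho.
have mx : measurable_fun [set: T] (load_reduction e a) by apply: measurable_funD.
have mr : measurable_fun [set: T] (fun w => rho (load_reduction e a w)).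
  exact: measurableT_comp.
rewrite /customer_utility /linear_bonus /effort_cost /falsification_cost /=.
apply: measurable_funB; [apply: measurable_funB; [apply: measurable_funD|]|] => //.
- exact: measurable_funM.
- by apply: measurable_funM => //; exact: measurable_funB.
- apply: measurable_funM => //; apply: measurable_funM => //.
  by apply: measurable_funX; exact: measurable_funB.
Qed.

Lemma expected_utility_shift_report (a : R) :
  EV a rep =
  ((alpha + mu) * a - a ^+ 2 / 2 - mu * R0 + mu ^+ 2 / (2 * beta))%:E.
Proof.
rewrite /expected_customer_utility.
set c := (X in _ = X%:E).
(* At the report [rep] the square in the report vanishes, leaving a utility affine in the noise with
   slope [alpha + mu]. *)
have [_ <-] := expectation_affine c (alpha + mu) noise_integrable Ee.
congr expectation; apply/funext => w /=.
rewrite customer_utility_square ?gt_eqF// /load_reduction /c.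
ring.
Qed.

Lemma customer_utility_le_shift_report (a x r : R) :
  customer_utility alpha beta (linear_bonus R0 mu) a x r <=
  customer_utility alpha beta (linear_bonus R0 mu) a x (rep x).
Proof.
rewrite !customer_utility_square ?gt_eqF// lerD2l lerN2 subrr expr0n mulr0.
by rewrite mulr_ge0 ?sqr_ge0// divr_ge0// ltW.
Qed.

(** The domination is pointwise in the noise, so it also covers reporting rules whose expected
    utility is [-oo]. *)
Lemma expected_utility_le_shift_report (a : R) (rho : R -> R) :
  measurable_fun [set: R] rho -> (EV a rho <= EV a rep)%E.
Proof.
move=> mrho; apply: le_expectation_measurable.
- exact: measurable_customer_utility.
- exact: measurable_customer_utility measurable_shift_report.
- by move=> w; exact: customer_utility_le_shift_report.
Qed.

Lemma best_response_shift_report :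
  best_response e beta R0 mu alpha (alpha + mu) rep.
Proof.
split; first exact: measurable_shift_report.
move=> a rho mrho; apply: le_trans (expected_utility_le_shift_report a mrho) _.
rewrite !expected_utility_shift_report lee_fin -subr_ge0.
rewrite [leRHS](_ : _ = (alpha + mu - a) ^+ 2 / 2); last by field; rewrite gt_eqF.
by rewrite divr_ge0// sqr_ge0.
Qed.

(** Comparison with effort [alpha + mu] and report [rep] fixes the effort; then [rho] and [rep] have
    equal expected utility, and pointwise domination makes the utilities agree almost surely.
    Changing [rho] on values of [x] of probability zero leaves the expectation unchanged, hence the
    almost-sure conclusion. *)
Lemma best_responseP (a : R) (rho : R -> R) :
  best_response e beta R0 mu alpha a rho ->
  a = alpha + mu /\
  {ae P, forall w, let x := load_reduction e a w in rho x = rep x}.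
Proof.
move=> [mrho opt].
have le1 := opt (alpha + mu) _ measurable_shift_report.
have le2 := expected_utility_le_shift_report a mrho.
have aE : a = alpha + mu.
  have := le_trans le1 le2.
  rewrite !expected_utility_shift_report lee_fin -subr_ge0.
  rewrite [leRHS](_ : _ = - ((a - (alpha + mu)) ^+ 2 / 2)); last first.
    by field; rewrite gt_eqF.
  rewrite oppr_ge0 pmulr_lle0 ?invr_gt0// => sq_le0.
  by apply/eqP; rewrite -subr_eq0 -sqrf_eq0 eq_le sq_le0 sqr_ge0.
split=> //; rewrite -aE in le1.
have Eeq : EV a rho = EV a rep by apply/eqP; rewrite eq_le le1 le2.
have := eq_expectation_ae_eq (measurable_customer_utility a mrho)
  (measurable_customer_utility a measurable_shift_report)
  (fun w => customer_utility_le_shift_report a (load_reduction e a w) _) Eeq.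
rewrite -/(EV a rep) expected_utility_shift_report => /(_ isT).
apply: filterS => w /=; rewrite !customer_utility_square ?gt_eqF//.
(* After cancellation only [beta / 2 * (rho x - rep x) ^+ 2 = 0] remains. *)
rewrite subrr expr0n mulr0 => /addrI /oppr_inj /eqP.
rewrite mulf_eq0 sqrf_eq0 subr_eq0 gt_eqF/= ?divr_gt0//.
by move=> /eqP.
Qed.

Lemma incentive_compatible_shift_report :
  incentive_compatible beta mu rep.
Proof.
split=> x; first by rewrite addrAC subrr add0r mulrC divfK// gt_eqF.
split; first exact: derivableD.
by rewrite derive1E deriveD// derive_id derive_cst addr0.
Qed.

(** Solving [mu = beta * (rho x - x)] for [rho x] determines the report at every [x], not merely
    almost surely. *)
Lemma incentive_compatibleE (rho : R -> R) :
  incentive_compatible beta mu rho -> rho = rep.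
Proof.
move=> [IC _]; apply/funext => x.
by rewrite (IC x) mulrAC divff ?gt_eqF// mul1r addrC subrK.
Qed.

End response.

(** * The aggregator's optimization over contracts *)

Section aggregator.
Context {d : measure_display} {T : measurableType d} {R : realType}.
Variables (P : probability T R) (N : nat) (e : 'I_N -> {RV P >-> R}).
Variables (beta_ : 'I_N -> R) (beta R0 : R).
Hypotheses (Ee : forall i, 'E_P[e i]%E = 0%:E).
Hypotheses (beta_gt0 : 0 < beta) (beta_E : forall i, beta_ i = beta).

Lemma expected_DRA_utility_shift_report (mu : R) (alpha a : 'I_N -> R) :
  expected_DRA_utility e R0 mu alpha a (fun _ x => x + mu / beta) =
  (\sum_(i < N) ((1 - alpha i - mu) * a i - mu * (mu / beta - R0)))%:E.
Proof.
(* Customer [i] contributes [c i + k i * e i] to the aggregator's utility. *)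
pose c i := (1 - alpha i - mu) * a i - mu * (mu / beta - R0).
pose k i := 1 - alpha i - mu.
have cP i := expectation_affine (c i) (k i) (noise_integrable (Ee i)) (Ee i).
rewrite /expected_DRA_utility.
transitivity (\int[P]_w (\sum_(i < N) (c i + k i * e i w)%:E))%E.
  rewrite unlock; apply: eq_integral => w _; rewrite sumEFin; congr EFin.
  rewrite /DRA_utility /linear_bonus /load_reduction -sumrB.
  by apply: eq_bigr => i _; rewrite /c /k; ring.
rewrite integral_sum//; last by move=> i; case: (cP i).
rewrite -sumEFin; apply: eq_bigr => i _.
by have [_ <-] := cP i; rewrite unlock.
Qed.

(** Best response fixes the effort and incentive compatibility the report, so only the contract
    remains free and individual rationality becomes a scalar inequality. *)
Lemma P2_feasibleP (mu : R) (alpha a : 'I_N -> R) (rho : 'I_N -> R -> R) :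
  P2_feasible e beta_ R0 mu alpha a rho <->
  [/\ a = (fun i => alpha i + mu), rho = (fun _ x => x + mu / beta), 0 <= mu &
      forall i, 0 <= (alpha i + mu) ^+ 2 / 2 - mu * R0 + mu ^+ 2 / (2 * beta)].
Proof.
have EVE i := expected_utility_shift_report R0 mu (alpha i) beta_gt0 (Ee i)
  (alpha i + mu).
have sqE (s : R) : s * s - s ^+ 2 / 2 = s ^+ 2 / 2 by field.
split=> [[br mu0 ir ic]|[-> -> mu0 ir]].
  have aE : a = fun i => alpha i + mu.
    apply/funext => i; have := br i; rewrite beta_E.
    by move=> /(best_responseP beta_gt0 (Ee i)) [].
  have rhoE : rho = fun _ x => x + mu / beta.
    apply/funext => i; have := ic i; rewrite beta_E.
    exact: incentive_compatibleE.
  split=> // i; have := ir i.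
  by rewrite beta_E aE rhoE EVE lee_fin sqE.
split=> // i; rewrite beta_E.
- exact: best_response_shift_report.
- by rewrite EVE lee_fin sqE.
- exact: incentive_compatible_shift_report.
Qed.

(** The aggregator's expected utility once efforts and reports are the customers' responses. *)
Let welfare (mu : R) (alpha : 'I_N -> R) : R :=
  \sum_(i < N) ((1 - alpha i - mu) * (alpha i + mu) - mu * (mu / beta - R0)).

(** Expanding the concave quadratic around its maximizer leaves only squares: their sign gives
    optimality, their vanishing uniqueness. *)
Lemma welfare_gap (mu : R) (alpha : 'I_N -> R) :
  welfare (R0 * beta / 2) (fun=> 1 / 2 - R0 * beta / 2) - welfare mu alpha =
  \sum_(i < N) ((alpha i + mu - 1 / 2) ^+ 2 + (mu - R0 * beta / 2) ^+ 2 / beta).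
Proof.
rewrite /welfare -sumrB; apply: eq_bigr => i _.
by field; rewrite gt_eqF.
Qed.

Hypotheses (N_gt0 : (0 < N)%N) (R0_ge0 : 0 <= R0).
Hypothesis IR : 3 * beta * R0 ^+ 2 <= 1.

Lemma gap_term_ge0 (mu : R) (alpha : 'I_N -> R) (i : 'I_N) :
  0 <= (alpha i + mu - 1 / 2) ^+ 2 + (mu - R0 * beta / 2) ^+ 2 / beta.
Proof. by rewrite addr_ge0 ?divr_ge0 ?sqr_ge0// ltW. Qed.

Lemma optimal_contractP (mu : R) (alpha : 'I_N -> R) :
  optimal_contract e beta_ R0 mu alpha <->
  mu = R0 * beta / 2 /\ (forall i, alpha i = 1 / 2 - mu).
Proof.
have star : P2_feasible e beta_ R0 (R0 * beta / 2)
    (fun=> 1 / 2 - R0 * beta / 2) (fun=> 1 / 2 - R0 * beta / 2 + R0 * beta / 2)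
    (fun _ x => x + R0 * beta / 2 / beta).
  apply/P2_feasibleP; split=> //.
    by rewrite divr_ge0// mulr_ge0// ltW.
  move=> _; rewrite subrK.
  (* The three terms are [1 / 8], [- beta * R0 ^+ 2 / 2] and [beta * R0 ^+ 2 / 8]. *)
  rewrite [leRHS](_ : _ = (1 - 3 * beta * R0 ^+ 2) / 8); last first.
    by field; rewrite gt_eqF.
  by rewrite divr_ge0// subr_ge0.
split=> [[a [rho [/P2_feasibleP[-> -> mu0 ir] opt]]]|[-> alphaE]].
  (* Optimality against the candidate [star] makes the gap nonpositive, so each of its nonnegative
     terms is zero. *)
  have := opt _ _ _ _ star.
  rewrite !expected_DRA_utility_shift_report lee_fin -subr_le0.
  rewrite -!/(welfare _ _) welfare_gap => gap_le0.
  have gap0 : \sum_(i < N) ((alpha i + mu - 1 / 2) ^+ 2 +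
      (mu - R0 * beta / 2) ^+ 2 / beta) == 0.
    by rewrite eq_le gap_le0 sumr_ge0// => i _; exact: gap_term_ge0.
  move: gap0; rewrite psumr_eq0; last by move=> i _; exact: gap_term_ge0.
  move=> /allP gap0.
  have {}gap0 i : alpha i + mu = 1 / 2 /\ mu = R0 * beta / 2.
    have := gap0 i (mem_index_enum i) => /=.
    rewrite paddr_eq0 ?sqr_ge0// ?divr_ge0 ?sqr_ge0 ?ltW//.
    rewrite sqrf_eq0 mulf_eq0 sqrf_eq0 invr_eq0 (gt_eqF beta_gt0) orbF.
    by rewrite !subr_eq0 => /andP[/eqP -> /eqP ->].
  (* The value of [mu] is read off customer [0], who exists because [0 < N]. *)
  split=> [|i]; first by case: (gap0 (Ordinal N_gt0)).
  by have [<- _] := gap0 i; rewrite addrK.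
have -> : alpha = fun=> 1 / 2 - R0 * beta / 2 by exact/funext.
exists (fun=> 1 / 2 - R0 * beta / 2 + R0 * beta / 2).
exists (fun _ x => x + R0 * beta / 2 / beta).
split=> // mu' alpha' a' rho' /P2_feasibleP[-> -> _ _].
rewrite !expected_DRA_utility_shift_report lee_fin -subr_ge0.
rewrite -!/(welfare _ _) welfare_gap.
by apply: sumr_ge0 => i _; exact: gap_term_ge0.
Qed.

End aggregator.

Unset Implicit Arguments.

Theorem theorem5 (d : measure_display) (T : measurableType d) (R : realType)
  (P : probability T R) (N : nat) (e : 'I_N -> {RV P >-> R})
  (sigma : R) (beta_ : 'I_N -> R) (beta R0 : R)
  (hN : (0 < N)%N)
  (he : iid_noise e sigma)
  (hbeta_gt0 : forall i, 0 < beta_ i)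
  (hbeta : forall i, beta_ i = beta)
  (hR0 : 0 <= R0)
  (* equivalent to individual rationality of the contract below *)
  (hIR : 3 * beta * R0 ^+ 2 <= 1) :
  (forall (mu : R) (alpha : 'I_N -> R),
     optimal_contract e beta_ R0 mu alpha <->
     mu = R0 * beta / 2 /\ (forall i, alpha i = 1 / 2 - mu)) /\
  (forall (mu : R) (alpha : 'I_N -> R),
     optimal_contract e beta_ R0 mu alpha ->
     forall (i : 'I_N) (a : R) (rho : R -> R),
       best_response (e i) (beta_ i) R0 mu (alpha i) a rho ->
       [/\ a = mu + alpha i,
           {ae P, forall w, let x := load_reduction (e i) a w in
                            rho x = x + mu / beta} &
           incentive_compatible (beta_ i) mu rho ->
           forall x, rho x = x + mu / beta /\ x <= rho x]).
Proof.
have [_ _ Ee _] := he.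
have beta_gt0 : 0 < beta by rewrite -(hbeta (Ordinal hN)).
have optP := optimal_contractP Ee beta_gt0 hbeta hN hR0 hIR.
split=> // mu alpha [a0 [rho0 [[_ mu0 _ _] _]]] i a rho.
rewrite hbeta => /(best_responseP beta_gt0 (Ee i)) [-> rhoE].
split=> [|//|/(incentive_compatibleE beta_gt0) -> x]; first by rewrite addrC.
(* Over-reporting comes from [0 <= mu], part of the feasibility of the optimal contract. *)
by split=> //; rewrite lerDl divr_ge0// ltW.
Qed.
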